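(* Let $\gamma_1=\gamma_1(\epsilon)$ and $\gamma_2=\gamma_2(\epsilon)$ satisfy $0<\gamma_1<\gamma_2<1$, and let $T_1,T_2,T=T_2\circ T_1$ be the maps (depending on $\epsilon$) defined in the context. Assume that $\gamma_1$ and $\gamma_2$ monotonically tend to zero as $\epsilon\searrow 0$, as well as the quantities $\gamma_1/\gamma_2$ and $\epsilon/\gamma_2$, and that $\lim_{\epsilon\downarrow0}\epsilon\gamma_2/\gamma_1=0$. For all sufficiently small $\epsilon>0$, let $\mathcal{U}^{\ast}=\mathcal{U}^{\ast}(\epsilon)$ be the limit as $n\to\infty$ of the (convergent, for such $\epsilon$) sequence defined by $\mathcal{U}_0:=T_2(0)$, $\mathcal{U}_{n+1}:=T(\mathcal{U}_n)$, and let $\alpha^{\ast}:=T_1(\mathcal{U}^{\ast})$. Then $$\lim_{\epsilon\downarrow 0}\alpha^{\ast}=0 .$$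
   Context: Roughness and micro-domain. $\varphi:\mathbb{R}\to\mathbb{R}$ is a fixed bounded, Lipschitz continuous, $1$-periodic function with $\varphi\ge 0$, $H:=\|\varphi\|_\infty>0$, and $\varphi(N)=H$ for every $N\in\mathbb{Z}$. For small $\epsilon>0$ put $M:=\epsilon H$. The rough boundary (whose maximum height is $x_2=0$) is $\Gamma_\epsilon=\{(x_1,x_2): 0\le x_1\le\epsilon,\ x_2=\epsilon\varphi(x_1/\epsilon)-\epsilon H\}$. For heights $0<\gamma_1<\gamma_2<1$ (which may depend on $\epsilon$) the micro-domain is $\Omega^{\rm mic}=\{(x_1,x_2):0<x_1<\epsilon,\ \epsilon\varphi(x_1/\epsilon)-\epsilon H<x_2<\gamma_2\}$. Let $e_1=(1,0)$. Auxiliary Stokes flows. All flows in $\Omega^{\rm mic}$ are velocity–pressure pairs, $\epsilon$-periodic in $x_1$ (periodic at the side walls $x_1=0$ and $x_1=\epsilon$), solving the homogeneous Stokes system $-\Delta u+\nabla p=0$, $\nabla\cdot u=0$ (weakly). (i) $u_2$ is the solution with $u_2=0$ at $x_2=\gamma_2$ and $u_2=-(x_2+M)(\gamma_2-x_2)\,e_1$ on $\Gamma_\epsilon$. (ii) $\tilde u_3$ is the solution with $\tilde u_3=e_1$ at $x_2=\gamma_2$ and $\tilde u_3=0$ on $\Gamma_\epsilon$. Define the real numbers $\overline{B}_2:=\int_0^\epsilon u_2(x_1,0)\cdot e_1\,dx_1$ and $\tilde B_3:=\int_0^\epsilon\tilde u_3(x_1,0)\cdot e_1\,dx_1$. Maps.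 The macro-to-micro map is $$T_2(\alpha):=-\gamma_2^2+\left(\frac{\gamma_1^2-1-2\gamma_1\alpha}{\gamma_1-1-\alpha}\right)(\gamma_2-1)+1 ,$$ considered for $\alpha\ge0$ and, by the same formula, wherever its denominator is nonzero. The micro-to-macro map is $$T_1(\mathcal{U}):=\frac{C_1+C_2\,\mathcal{U}}{C_3+(1-\tilde B_3)\,\mathcal{U}},\qquad \mathcal{U}\in\mathbb{R},$$ (wherever its denominator is nonzero), with $C_1=\epsilon\gamma_2(\gamma_1+M)(\gamma_2-\gamma_1)+\overline{B}_2(\gamma_2-\gamma_1)$, $C_2=\tilde B_3(\gamma_2-\gamma_1)+\gamma_1$, $C_3=\epsilon\gamma_2(\gamma_2-2\gamma_1-M)-\overline{B}_2$. Finally $T(\mathcal{U}):=T_2(T_1(\mathcal{U}))$. All these objects depend on $\epsilon$. *)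

(* Defs.v *)
From HB Require Import structures.
From mathcomp Require Import all_boot all_order all_algebra.
From mathcomp Require Import all_classical all_reals all_analysis.

Set Implicit Arguments.
Unset Strict Implicit.
Unset Printing Implicit Defensive.

Import Order.TTheory GRing.Theory Num.Theory.
Import numFieldNormedType.Exports.

Local Open Scope classical_set_scope.
Local Open Scope ring_scope.

Definition profile_height {R : realType} (phi : R -> R) : R :=
  sup (range (fun s => `|phi s|)).

Record rough_profile {R : realType} (phi : R -> R) : Prop := RoughProfile {
  profile_bounded : bounded_fun phi;
  profile_lipschitz : lipschitz phi;
  profile_periodic : forall s, phi (s + 1) = phi s;
  profile_ge0 : forall s, 0 <= phi s;
  profile_height_gt0 : 0 < profile_height phi;
  profile_max : forall N : int, phi N%:~R = profile_height phi
}.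

Definition roughM {R : realType} (phi : R -> R) (eps : R) : R :=
  eps * profile_height phi.

(* Gamma_eps is the graph of this function over [0, eps]. *)
Definition rough_graph {R : realType} (phi : R -> R) (eps x1 : R) : R :=
  eps * phi (x1 / eps) - roughM phi eps.

Definition micro_domain {R : realType} (phi : R -> R) (eps gamma2 : R) :
    set (R * R) :=
  [set x | [/\ 0 < x.1, x.1 < eps, rough_graph phi eps x.1 < x.2
             & x.2 < gamma2]].

Definition leb2 {R : realType} :=
  ((@lebesgue_measure R) \x (@lebesgue_measure R))%E.

Definition square_integrable d (T : measurableType d) (R : realType)
    (mu : {measure set T -> \bar R}) (D : set T) (f : T -> R) : Prop :=
  measurable_fun D f /\ (\int[mu]_(x in D) (f x ^+ 2)%:E < +oo)%E.

Definition L2_cvg d (T : measurableType d) (R : realType)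
    (mu : {measure set T -> \bar R}) (D : set T)
    (f_ : nat -> T -> R) (f : T -> R) : Prop :=
  (\int[mu]_(x in D) ((f_ k x - f x) ^+ 2)%:E)%E @[k --> \oo] --> 0%E.

(* Coordinate directions: index 0 is x_1, index 1 is x_2. *)
Definition coord_dir {R : realType} (j : 'I_2) : R * R :=
  ((j == 0)%:R, (j == 1)%:R).

Definition partial {R : realType} (j : 'I_2) (f : R * R -> R) : R * R -> R :=
  'D_(coord_dir j) f.

Definition C1_periodic {R : realType} (eps : R) (f : R * R -> R) : Prop :=
  [/\ forall j x, derivable f x (coord_dir j),
      continuous f,
      forall j, continuous (partial j f)
    & forall x, f (x.1 + eps, x.2) = f x].

Definition H1_approx {R : realType} (phi : R -> R) (eps gamma2 : R)
    (f_ : nat -> R * R -> R) (f : R * R -> R) (df : 'I_2 -> R * R -> R) : Prop :=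
  [/\ forall k, C1_periodic eps (f_ k),
      L2_cvg leb2 (micro_domain phi eps gamma2) f_ f
    & forall j, L2_cvg leb2 (micro_domain phi eps gamma2)
                  (fun k => partial j (f_ k)) (df j)].

(* [f] belongs to the periodic Sobolev space H^1 of the micro-domain, with weak
   gradient [df]: the H^1-closure of the x_1-periodic functions that are C^1 up
   to the boundary.  Periodicity at the side walls is built into the closure. *)
Definition H1_periodic {R : realType} (phi : R -> R) (eps gamma2 : R)
    (f : R * R -> R) (df : 'I_2 -> R * R -> R) : Prop :=
  [/\ square_integrable leb2 (micro_domain phi eps gamma2) f,
      forall j, square_integrable leb2 (micro_domain phi eps gamma2) (df j)
    & exists f_, H1_approx phi eps gamma2 f_ f df].

(* [t] is the trace of the H^1 function [f] on the curve {x_2 = c(x_1)}, as an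
   L^2 function of x_1: the continuous extension to H^1 of the restriction of
   C^1 functions to the curve. *)
Definition H1_trace {R : realType} (phi : R -> R) (eps gamma2 : R)
    (f : R * R -> R) (df : 'I_2 -> R * R -> R) (c : R -> R) (t : R -> R) : Prop :=
  square_integrable lebesgue_measure `]0, eps[ t /\
  exists f_, H1_approx phi eps gamma2 f_ f df /\
    L2_cvg lebesgue_measure `]0, eps[ (fun k s => f_ k (s, c s)) t.

(* The pair ([u], [p]) is a weak solution, periodic in x_1, of the homogeneous
   Stokes system in the micro-domain with velocity [bot] on Gamma_eps and
   velocity [top] on {x_2 = gamma2}; [du i j] is the weak derivative of the
   i-th component in the j-th direction.  The pressure is in L^2, where
   periodicity is a natural condition: it is carried by the periodicity of the
   test functions. *)
Record stokes_flow {R : realType} (phi : R -> R) (eps gamma2 : R)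
    (bot top : 'I_2 -> R * R -> R)
    (u : 'I_2 -> R * R -> R) (du : 'I_2 -> 'I_2 -> R * R -> R)
    (p : R * R -> R) : Prop := StokesFlow {
  flow_H1 : forall i, H1_periodic phi eps gamma2 (u i) (du i);
  flow_pressure : square_integrable leb2 (micro_domain phi eps gamma2) p;
  flow_bot : forall i, H1_trace phi eps gamma2 (u i) (du i)
    (rough_graph phi eps) (fun s => bot i (s, rough_graph phi eps s));
  flow_top : forall i, H1_trace phi eps gamma2 (u i) (du i)
    (cst gamma2) (fun s => top i (s, gamma2));
  flow_div : {ae leb2, forall x, micro_domain phi eps gamma2 x ->
    \sum_(i < 2) du i i x = 0};
  flow_momentum : forall (v : 'I_2 -> R * R -> R) (dv : 'I_2 -> 'I_2 -> R * R -> R),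
    (forall i, [/\ H1_periodic phi eps gamma2 (v i) (dv i),
       H1_trace phi eps gamma2 (v i) (dv i) (rough_graph phi eps) (cst 0)
     & H1_trace phi eps gamma2 (v i) (dv i) (cst gamma2) (cst 0)]) ->
    \int[leb2]_(x in micro_domain phi eps gamma2)
       (\sum_(i < 2) \sum_(j < 2) du i j x * dv i j x)
    - \int[leb2]_(x in micro_domain phi eps gamma2)
       (p x * \sum_(i < 2) dv i i x) = 0
}.

Definition e1_field {R : realType} (a : R * R -> R) (i : 'I_2) (x : R * R) : R :=
  if i == 0 then a x else 0.

Definition is_flow_u2 {R : realType} (phi : R -> R) (eps gamma2 : R) :=
  stokes_flow phi eps gamma2
    (e1_field (fun x => - ((x.2 + roughM phi eps) * (gamma2 - x.2))))
    (e1_field (cst 0)).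

Definition is_flow_u3 {R : realType} (phi : R -> R) (eps gamma2 : R) :=
  stokes_flow phi eps gamma2 (e1_field (cst 0)) (e1_field (cst 1)).

(* [B] is the integral over 0 <= x_1 <= eps of u(x_1, 0) . e_1.  The values on
   the segment {x_2 = 0}, which touches Gamma_eps, are those of the trace. *)
Definition is_line_integral {R : realType} (phi : R -> R) (eps gamma2 : R)
    (u : 'I_2 -> R * R -> R) (du : 'I_2 -> 'I_2 -> R * R -> R) (B : R) : Prop :=
  exists2 t, H1_trace phi eps gamma2 (u 0) (du 0) (cst 0) t
           & B = \int[lebesgue_measure]_(s in `]0, eps[) t s.

Definition T2_den {R : realType} (g1 alpha : R) : R := g1 - 1 - alpha.

Definition T2 {R : realType} (g1 g2 alpha : R) : R :=
  - g2 ^+ 2 + ((g1 ^+ 2 - 1 - 2 * g1 * alpha) / T2_den g1 alpha) * (g2 - 1) + 1.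

Definition T1_den {R : realType} (eps M g1 g2 B2 B3 U : R) : R :=
  (eps * g2 * (g2 - 2 * g1 - M) - B2) + (1 - B3) * U.

Definition T1 {R : realType} (eps M g1 g2 B2 B3 U : R) : R :=
  ((eps * g2 * (g1 + M) * (g2 - g1) + B2 * (g2 - g1))
   + (B3 * (g2 - g1) + g1) * U) / T1_den eps M g1 g2 B2 B3 U.

Definition T12 {R : realType} (eps M g1 g2 B2 B3 U : R) : R :=
  T2 g1 g2 (T1 eps M g1 g2 B2 B3 U).

Definition U_seq {R : realType} (eps M g1 g2 B2 B3 : R) (n : nat) : R :=
  iter n (T12 eps M g1 g2 B2 B3) (T2 g1 g2 0).

Definition U_star {R : realType} (eps M g1 g2 B2 B3 : R) : R :=
  limn (U_seq eps M g1 g2 B2 B3).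

Definition alpha_star {R : realType} (eps M g1 g2 B2 B3 : R) : R :=
  T1 eps M g1 g2 B2 B3 (U_star eps M g1 g2 B2 B3).

(* All quotients in the definitions of U_seq and alpha_star have a nonzero
   denominator; division by zero is total here, so this must be said. *)
Definition iteration_defined {R : realType} (eps M g1 g2 B2 B3 : R) : Prop :=
  [/\ T2_den g1 0 != 0,
      forall n, T1_den eps M g1 g2 B2 B3 (U_seq eps M g1 g2 B2 B3 n) != 0,
      forall n, T2_den g1 (T1 eps M g1 g2 B2 B3 (U_seq eps M g1 g2 B2 B3 n)) != 0
    & T1_den eps M g1 g2 B2 B3 (U_star eps M g1 g2 B2 B3) != 0].

(* Main.v *)
Require Import Defs.
From HB Require Import structures.
From mathcomp Require Import all_boot all_order all_algebra.
From mathcomp Require Import all_classical all_reals all_analysis.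
From mathcomp Require Import measurable_realfun ring lra.

Import Order.TTheory GRing.Theory Num.Theory.
Import numFieldNormedType.Exports.

Local Open Scope classical_set_scope.
Local Open Scope ring_scope.

(** Write [g] for the height [gamma2].  When [gamma1 / gamma2], [eps / gamma2]
and [gamma2] are small, the iteration starts at
[T2 0 = g - gamma1 - g^2 + gamma1 g], which is close to [g].  On
[[g / 2, 2 g]] the denominator of [T1] is of order [g], while the numerator is
at most of order [gamma1 g + B3 g^2 + eps g^3 + B2 g]; hence [T1] takes values that
are a small multiple of [g] as soon as
[B2] is small compared with [g] and [B3] is small.  Since [T2] is the
translation by [T2 0] up to a factor close to 1, the interval is stable, and
the same estimates on the derivative of the Moebius map [T1] make the
composition a contraction.  The contraction principle gives the convergence,
and [alpha* = T1 U*] satisfies [|alpha*| <= g], so it tends to 0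
([T12_iteration]).

Only crude bounds on the two line integrals are therefore needed, and these
come from energy alone.  Let [u] be one of the flows, and let [W(x2) e1] be a
shear flow with the boundary values of [u].  It is divergence free, so
[u - W e1] is an admissible test field that does not see the pressure, and
the weak formulation bounds the energy of [u] by that of [W e1]
([dirichlet_energy_le]).  On the other hand the integral of the first component of
[u] along [{x2 = 0}] differs from the one along the flat top by the integral of
[d u_1 / d x2] over the rectangle [0 < x1 < eps, 0 < x2 < g] ([trace_flux]),
which the energy controls.  Together ([line_integral_near_top]): if
[|W'| <= K] then [|eps W(g) - B| <= K eps (g + M)].

For [u2] the shear is the boundary datum itself, [W = - (x2 + M) (g - x2)],
with [W(g) = 0] and [K = g + M], so that [B2 = O(eps g^2)].  For [u3] the
shear is [W = (max(x2, 0) / g)^2], which vanishes on the whole rough boundary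
because the latter lies in [x2 <= 0]; here [K = 2 / g], so that
[B3 = O(eps)]. *)

(** * The iteration *)

Lemma ler_normM {R : realType} (a b A B : R) :
  `|a| <= A -> `|b| <= B -> `|a * b| <= A * B.
Proof. by move=> aA bB; rewrite normrM ler_pM. Qed.

(** The constant 100 is arbitrary: it leaves room for the contraction factor 1/2. *)
Definition small_regime {R : realType} (eps M g1 g2 B2 B3 : R) : Prop :=
  [/\ 0 < eps <= 100^-1, 0 <= M <= g2 / 100, 0 < g1 <= g2 / 100,
      0 < g2 <= 100^-1 & (`|B2| <= g2 / 100) /\ `|B3| <= 100^-1].

(** The coefficients [C1], [C2], [C3] of [T1].  The bound on [C1] is the delicate
one: [T1_lipschitz] needs [1/2500 + 2 c <= 1/25] when it is [c g2^2]. *)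
Lemma T1_coefs {R : realType} {eps M g1 g2 B2 B3 : R} :
  small_regime eps M g1 g2 B2 B3 ->
  [/\ `|eps * g2 * (g1 + M) * (g2 - g1) + B2 * (g2 - g1)| <= g2 ^+ 2 / 60,
      `|B3 * (g2 - g1) + g1| <= g2 / 50
    & `|eps * g2 * (g2 - 2 * g1 - M) - B2| <= g2 / 50].
Proof.
move=> [/andP[e0 e1] /andP[M0 M1] /andP[g10 g11] /andP[g20 g21] [hB2 hB3]].
have h1 : `|g2 - g1| <= g2 by rewrite ger0_norm; lra.
have h2 : `|eps * g2| <= 100^-1 * 100^-1.
  by apply: ler_normM; rewrite gtr0_norm.
have h3 : `|g1 + M| <= g2 / 50 by rewrite ger0_norm; lra.
have h4 : `|g2 - 2 * g1 - M| <= g2 by rewrite ger0_norm; lra.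
split.
- rewrite -mulrDl [leRHS](_ : _ = (g2 / 60) * g2); last by field.
  apply: ler_normM => //; apply: (le_trans (ler_normD _ _)).
  by have := ler_normM _ _ _ _ h2 h3; lra.
- apply: (le_trans (ler_normD _ _)); rewrite (gtr0_norm g10).
  by have := ler_normM _ _ _ _ hB3 h1; lra.
- apply: (le_trans (ler_normB _ _)).
  by have := ler_normM _ _ _ _ h2 h4; lra.
Qed.

(** The term [(1 - B3) U] is at least [0.49 g2] and dominates the constant term
of the denominator. *)
Lemma T1_den_ge {R : realType} {eps M g1 g2 B2 B3 U : R} :
  small_regime eps M g1 g2 B2 B3 -> g2 / 2 <= U ->
  g2 / 5 * 2 <= T1_den eps M g1 g2 B2 B3 U.
Proof.
move=> h; have [_ _] := T1_coefs h.
move: h => [/andP[e0 e1] /andP[M0 M1] /andP[g10 g11] /andP[g20 g21] [hB2 hB3]].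
rewrite /T1_den; set c := _ - B2; move=> /ler_normlP[c1 c2] gU.
move/ler_normlP : hB3 => [b1 b2]; nra.
Qed.

Lemma T1_small {R : realType} {eps M g1 g2 B2 B3 U : R} :
  small_regime eps M g1 g2 B2 B3 -> g2 / 2 <= U <= 2 * g2 ->
  `|T1 eps M g1 g2 B2 B3 U| <= g2 / 5.
Proof.
move=> h /andP[U1 U2]; have [c1 c2 _] := T1_coefs h.
have hd := T1_den_ge h U1.
move: h => [_ _ _ /andP[g20 g21] _].
have d0 : 0 < T1_den eps M g1 g2 B2 B3 U by lra.
rewrite /T1 normrM normfV (gtr0_norm d0) ler_pdivrMr//.
apply: (le_trans (ler_normD _ _)).
have hU : `|U| <= 2 * g2 by rewrite ger0_norm; lra.
have := ler_normM _ _ _ _ c2 hU.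
have : g2 / 5 * (g2 / 5 * 2) <= g2 / 5 * T1_den eps M g1 g2 B2 B3 U.
  by rewrite ler_pM2l //; lra.
have : 0 < g2 * g2 by rewrite mulr_gt0.
by rewrite expr2 in c1 *; lra.
Qed.

(** The difference of two values of a Moebius map is the determinant times
[U - V] over the product of the denominators.  The determinant is at most
[(1/2500 + 1/30) g2^2], the denominators are at least [2 g2 / 5]. *)
Lemma T1_lipschitz {R : realType} {eps M g1 g2 B2 B3 U V : R} :
  small_regime eps M g1 g2 B2 B3 -> g2 / 2 <= U -> g2 / 2 <= V ->
  `|T1 eps M g1 g2 B2 B3 U - T1 eps M g1 g2 B2 B3 V| <= `|U - V| / 4.
Proof.
move=> h hU hV; have [c1 c2 c3] := T1_coefs h.
have hdU := T1_den_ge h hU; have hdV := T1_den_ge h hV.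
move: h => [_ _ _ /andP[g20 g21] [_ hB3]].
have dU0 : 0 < T1_den eps M g1 g2 B2 B3 U by lra.
have dV0 : 0 < T1_den eps M g1 g2 B2 B3 V by lra.
rewrite /T1 -mulNr addf_div ?gt_eqF// normrM normfV.
rewrite [X in _ / X]gtr0_norm ?mulr_gt0// ler_pdivrMr ?mulr_gt0//.
have hden : g2 / 5 * 2 * (g2 / 5 * 2) <=
    T1_den eps M g1 g2 B2 B3 U * T1_den eps M g1 g2 B2 B3 V.
  by apply: ler_pM => //; lra.
have -> : `|U - V| / 4 * (T1_den eps M g1 g2 B2 B3 U * T1_den eps M g1 g2 B2 B3 V)
  = ((T1_den eps M g1 g2 B2 B3 U * T1_den eps M g1 g2 B2 B3 V) / 4) * `|U - V|.
  ring.
move: c1 c2 c3 hden; rewrite /T1_den.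
set C1 := _ + B2 * (g2 - g1); set C2 := _ + g1; set C3 := _ - B2.
move=> c1 c2 c3 hden.
rewrite [X in `|X|](_ : _ = (C2 * C3 - C1 * (1 - B3)) * (U - V)); last by ring.
rewrite normrM ler_wpM2r//; apply: (le_trans (ler_normB _ _)).
have h1 := ler_normM _ _ _ _ c2 c3.
have hb : `|1 - B3| <= 2.
  by apply: (le_trans (ler_normB _ _)); rewrite normr1; lra.
have h2 := ler_normM _ _ _ _ c1 hb.
move: h2; rewrite expr2 => h2.
have : 0 < g2 * g2 by rewrite mulr_gt0.
by lra.
Qed.

(** This form isolates the initial value [T2 0] and shows that the remainder
is nearly [a]. *)
Lemma T2E {R : realType} {g1 g2 a : R} : g1 - 1 - a != 0 -> g1 - 1 != 0 ->
  T2 g1 g2 a = g2 - g1 - g2 ^+ 2 + g1 * g2 + (1 - g2) * (1 - g1) * (a / (1 - g1 + a)).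
Proof.
move=> h1 h2; rewrite /T2 /T2_den; have h3 : 1 - g1 + a != 0.
  by rewrite -oppr_eq0; apply: contra h1 => /eqP <-; apply/eqP; ring.
by field; apply/andP.
Qed.

Lemma T2_range {R : realType} {g1 g2 a : R} :
  0 < g1 <= g2 / 100 -> 0 < g2 <= 100^-1 -> `|a| <= g2 / 5 ->
  g2 / 2 <= T2 g1 g2 a <= 2 * g2.
Proof.
move=> /andP[g10 g11] /andP[g20 g21] ha.
have /ler_normlP[a1 a2] := ha.
rewrite T2E; [|by rewrite lt_eqF//; lra..].
have hq : `|(1 - g2) * (1 - g1) * (a / (1 - g1 + a))| <= 1 * 1 * (g2 / 4).
  apply: ler_normM; first by apply: ler_normM; rewrite ger0_norm; lra.
  rewrite normrM normfV (@gtr0_norm _ (1 - g1 + a)); last lra.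
  by rewrite ler_pdivrMr; [nra|lra].
move/ler_normlP : hq => [q1 q2].
by apply/andP; split; nra.
Qed.

Lemma T2_lipschitz {R : realType} {g1 g2 a b : R} :
  0 < g1 <= g2 / 100 -> 0 < g2 <= 100^-1 ->
  `|a| <= g2 / 5 -> `|b| <= g2 / 5 ->
  `|T2 g1 g2 a - T2 g1 g2 b| <= 2 * `|a - b|.
Proof.
move=> /andP[g10 g11] /andP[g20 g21] /ler_normlP[a1 a2] /ler_normlP[b1 b2].
rewrite !T2E; [|by rewrite lt_eqF//; lra..].
have da : 0 < 1 - g1 + a by lra.
have db : 0 < 1 - g1 + b by lra.
rewrite [X in `|X|](_ : _ = ((1 - g2) * (1 - g1) * (1 - g1) /
  ((1 - g1 + a) * (1 - g1 + b))) * (a - b)); last first.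
  by field; rewrite !gt_eqF.
rewrite normrM ler_wpM2r// normrM normfV [X in _ / X]gtr0_norm ?mulr_gt0//.
rewrite ler_pdivrMr ?mulr_gt0//.
have h : `|(1 - g2) * (1 - g1) * (1 - g1)| <= 1 * 1 * 1.
  by do 2 ?apply: ler_normM; rewrite ger0_norm; lra.
by apply: (le_trans h); nra.
Qed.

(** The interval [[g2 / 2, 2 g2]] contains [T2 0], is mapped into itself and
is contracted by [T2 o T1].  As it is closed it contains the limit, so the
bounds on [T1] hold there as well. *)
Lemma T12_iteration {R : realType} {eps M g1 g2 B2 B3 : R} :
  small_regime eps M g1 g2 B2 B3 ->
  [/\ cvgn (U_seq eps M g1 g2 B2 B3),
      iteration_defined eps M g1 g2 B2 B3
    & `|alpha_star eps M g1 g2 B2 B3| <= g2].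
Proof.
move=> h; have [_ _ hg1 hg2 _] := h.
have /andP[g10 g11] := hg1; have /andP[g20 g21] := hg2.
pose I : set R := `[g2 / 2, 2 * g2]%classic.
pose F := T12 eps M g1 g2 B2 B3.
have IE U : I U -> g2 / 2 <= U <= 2 * g2 by rewrite /I/= in_itv.
have FI : {homo F : U / I U >-> I U}.
  move=> U /IE hU; rewrite /I/= in_itv; apply: T2_range => //.
  exact: T1_small.
have Flip U V : I U -> I V -> `|F U - F V| <= 2^-1 * `|U - V|.
  move=> /IE hU /IE hV; apply: (le_trans (T2_lipschitz hg1 hg2 _ _)).
  - exact: T1_small.
  - exact: T1_small.
  - have /andP[? _] := hU; have /andP[? _] := hV.
    by have := T1_lipschitz (U := U) (V := V) h; lra.
have I0 : I (T2 g1 g2 0).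
  by rewrite /I/= in_itv; apply: T2_range; rewrite ?normr0//; lra.
pose f : {fun I >-> I} := mkfun FI.
have hctr : contraction (2^-1)%:nng f.
  split => /=; first by lra.
  by move=> -[U V] /= [IU IV]; exact: Flip.
have Ucvg : cvgn (U_seq eps M g1 g2 B2 B3) := contraction_cvg hctr I0.
have Iseq n : I (U_seq eps M g1 g2 B2 B3 n).
  by elim: n => [|n IH]; [exact: I0|exact: (FI _ IH)].
have Istar : I (U_star eps M g1 g2 B2 B3).
  apply: closed_cvg Ucvg; last exact: nearW.
  exact: interval_closed.
have den U : I U -> T1_den eps M g1 g2 B2 B3 U != 0.
  move=> /IE/andP[hU _]; rewrite gt_eqF//; have := T1_den_ge h hU; lra.
split => //.
- split; [|by move=> n; exact: den| |exact: den].
  + by rewrite /T2_den lt_eqF//; lra.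
  + move=> n; rewrite /T2_den lt_eqF//.
    have := T1_small h (IE _ (Iseq n)); move=> /ler_normlP[? ?]; lra.
- have := T1_small h (IE _ Istar); rewrite -/(alpha_star _ _ _ _ _ _); lra.
Qed.

(** * Square-integrable functions and mean-square limits *)

Lemma square_integrable_mul {d} {T : measurableType d} {R : realType}
    {mu : {measure set T -> \bar R}} {D : set T} {f g : T -> R} :
  measurable D -> square_integrable mu D f -> square_integrable mu D g ->
  mu.-integrable D (EFin \o (f \* g)).
Proof.
move=> mD [mf fi] [mg gi].
have sq (h : T -> R) : measurable_fun D h ->
    (\int[mu]_(x in D) (h x ^+ 2)%:E < +oo)%E ->
    mu.-integrable D (EFin \o (fun x => h x ^+ 2)).
  move=> mh hi; apply/integrableP; split.
    by apply/measurable_EFinP; exact: measurable_funX.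
  by under eq_integral do rewrite /= ger0_norm ?sqr_ge0//.
have fg : mu.-integrable D
    (EFin \o (fun x => f x ^+ 2 + g x ^+ 2)).
  by have := integrableD mD (sq _ mf fi) (sq _ mg gi).
apply: le_integrable fg => //.
  by apply/measurable_EFinP; exact: measurable_funM.
move=> x _; rewrite /= lee_fin [leRHS]ger0_norm ?addr_ge0 ?sqr_ge0//.
by rewrite ler_norml; apply/andP; split; nra.
Qed.

Lemma square_integrable_cst {d} {T : measurableType d} {R : realType}
    {mu : {measure set T -> \bar R}} {D : set T} (c : R) :
  measurable D -> (mu D < +oo)%E -> square_integrable mu D (cst c).
Proof.
move=> mD muD; split => //=.
rewrite (integral_cst mu mD (c ^+ 2)%:E) lte_mul_pinfty//.
by rewrite lee_fin sqr_ge0.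
Qed.

Lemma square_integrable_integrable {d} {T : measurableType d} {R : realType}
    {mu : {measure set T -> \bar R}} {D : set T} {f : T -> R} :
  measurable D -> (mu D < +oo)%E -> square_integrable mu D f ->
  mu.-integrable D (EFin \o f).
Proof.
move=> mD muD fi.
have := square_integrable_mul mD (square_integrable_cst 1 mD muD) fi.
by apply: eq_integrable => // x _ /=; rewrite mul1r.
Qed.

Lemma square_integrableB {d} {T : measurableType d} {R : realType}
    {mu : {measure set T -> \bar R}} {D : set T} {f g : T -> R} :
  measurable D -> square_integrable mu D f -> square_integrable mu D g ->
  square_integrable mu D (fun x => f x - g x).
Proof.
move=> mD fi gi; have [mf _] := fi; have [mg _] := gi.
split; first exact: measurable_funB.
have mf2 := square_integrable_mul mD fi fi.
have mg2 := square_integrable_mul mD gi gi.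
have mfg := square_integrable_mul mD fi gi.
have /integrableP[_] := integrableB mD (integrableD mD mf2 mg2)
  (integrableD mD mfg mfg).
apply: le_lt_trans; apply: ge0_le_integral => //.
- by move=> x _; rewrite lee_fin sqr_ge0.
- by apply/measurable_EFinP; apply: measurable_funX; exact: measurable_funB.
- apply: measurableT_comp => //; apply: emeasurable_funB.
  + by apply: emeasurable_funD; apply/measurable_EFinP; exact: measurable_funM.
  + by apply: emeasurable_funD; apply/measurable_EFinP; exact: measurable_funM.
- move=> x _ /=; rewrite lee_fin; apply: le_trans (ler_norm _).
  by rewrite le_eqVlt; apply/orP; left; apply/eqP; ring.
Qed.

Lemma square_integrableS {d} {T : measurableType d} {R : realType}
    {mu : {measure set T -> \bar R}} {D E : set T} {f : T -> R} :
  measurable D -> measurable E -> E `<=` D ->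
  square_integrable mu D f -> square_integrable mu E f.
Proof.
move=> mD mE ED [mf fi]; split; first exact: measurable_funS mf.
apply: le_lt_trans fi; apply: ge0_subset_integral => //.
- by apply/measurable_EFinP; exact: measurable_funX.
- by move=> x _; rewrite lee_fin sqr_ge0.
Qed.

Lemma L2_cvg_subset {d} {T : measurableType d} {R : realType}
    {mu : {measure set T -> \bar R}} {D E : set T} {f_ : nat -> T -> R}
    {f : T -> R} :
  measurable D -> measurable E -> E `<=` D ->
  (forall k, measurable_fun D (f_ k)) -> measurable_fun D f ->
  L2_cvg mu D f_ f -> L2_cvg mu E f_ f.
Proof.
move=> mD mE ED mf_ mf; rewrite /L2_cvg => h.
apply: (@squeeze_cvge _ _ _ _ (cst 0%E) _
  (fun k => \int[mu]_(x in D) ((f_ k x - f x) ^+ 2)%:E)%E) => //.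
  apply: nearW => k; rewrite integral_ge0/=; last first.
    by move=> x _; rewrite lee_fin sqr_ge0.
  apply: ge0_subset_integral => //.
  - by apply/measurable_EFinP; apply: measurable_funX; exact: measurable_funB.
  - by move=> x _; rewrite lee_fin sqr_ge0.
exact: cvg_cst.
Qed.

(** Let [m] be the measure of [D], [K] a bound of the weight, [q] the squared
distance in mean and [t > 0].  By [|y| <= t / 2 + y^2 / (2 t)] the error is at
most [K t m / 2 + K q / (2 t)], hence at most [K t (m + 1) / 2] once
[q <= t^2]. *)
Lemma L2_cvg_Rintegral {d} {T : measurableType d} {R : realType}
    {mu : {measure set T -> \bar R}} {D : set T} {h : T -> R}
    {f_ : nat -> T -> R} {f : T -> R} :
  measurable D -> (mu D < +oo)%E ->
  measurable_fun D h -> [bounded h x | x in D] ->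
  (forall k, mu.-integrable D (EFin \o f_ k)) -> square_integrable mu D f ->
  L2_cvg mu D f_ f ->
  \int[mu]_(x in D) (h x * f_ k x) @[k --> \oo] -->
  \int[mu]_(x in D) (h x * f x).
Proof.
move=> mD muD mh bh fki fi cf.
have fint := square_integrable_integrable mD muD fi.
have mfk k : measurable_fun D (f_ k) by apply/measurable_EFinP/(measurable_int _ (fki k)).
have mf := fi.1.
have hI (g : T -> R) : mu.-integrable D (EFin \o g) ->
    mu.-integrable D (EFin \o (fun x => h x * g x)).
  by move=> gi; have := integrableMr mD mh bh gi.
have [K K0 hK] : exists2 K, 0 < K & forall x, D x -> `|h x| <= K.
  have [M [_ hM]] := bh; exists (`|M| + 1) => [|x Dx]; first by rewrite ltr_wpDl.
  by apply: (hM (`|M| + 1)) => //; rewrite ltr_pwDr// ler_norm.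
pose m := fine (mu D).
have m0 : 0 <= m by rewrite fine_ge0.
apply/cvgrPdist_le => e e0.
have [t t0 tE] : exists2 t, 0 < t & K * t * (m + 1) = e.
  exists (e / (K * (m + 1))); first by rewrite divr_gt0// mulr_gt0// ltr_wpDl.
  by field; rewrite !gt_eqF// ltr_wpDl.
have : \forall k \near \oo, (\int[mu]_(x in D) ((f_ k x - f x) ^+ 2)%:E < (t ^+ 2)%:E)%E.
  apply: (cf [set y | (y < (t ^+ 2)%:E)%E]); apply: open_nbhs_nbhs; split.
    exact: open_ereal_lt_ereal.
  by rewrite /= lte_fin exprn_gt0.
apply: filterS => k hk.
have sqi : mu.-integrable D (EFin \o (fun x => (f_ k x - f x) ^+ 2)).
  apply/integrableP; split.
    by apply/measurable_EFinP; apply: measurable_funX; exact: measurable_funB.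
  under eq_integral do rewrite /= ger0_norm ?sqr_ge0//.
  by apply: (lt_trans hk); rewrite ltry.
have ki : mu.-integrable D (EFin \o (fun x => h x * f_ k x)) by exact: hI.
have li : mu.-integrable D (EFin \o (fun x => h x * f x)) by exact: hI.
rewrite -RintegralB//.
have ci (c : R) : mu.-integrable D (EFin \o cst c).
  exact: square_integrable_integrable (square_integrable_cst c mD muD).
have di : mu.-integrable D (EFin \o (fun x => h x * f x - h x * f_ k x)).
  by have := integrableB mD li ki.
have bi : mu.-integrable D
    (EFin \o (fun x => K * t / 2 + K / (2 * t) * (f_ k x - f x) ^+ 2)).
  have := integrableD mD (ci (K * t / 2)) (integrableZl mD (K / (2 * t)) sqi).
  by apply: eq_integrable => // x _.
apply: (le_trans (le_normr_Rintegral mD di)).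
apply: (@le_trans _ _ (\int[mu]_(x in D) (K * t / 2 + K / (2 * t) * (f_ k x - f x) ^+ 2))).
  apply: le_Rintegral => //.
    by have := integrable_norm di.
  move=> x Dx; rewrite -mulrBr normrM.
  apply: (@le_trans _ _ (K * `|f x - f_ k x|)).
    by rewrite ler_wpM2r// hK.
  rewrite -[(f_ k x - f x) ^+ 2]sqrrN opprB -(real_normK (num_real (f x - f_ k x))).
  set y := `|f x - f_ k x|.
  (* The inequality is a multiple of [0 <= (y - t) ^+ 2]. *)
  rewrite -subr_ge0 [leRHS](_ : _ = K / (2 * t) * (y - t) ^+ 2).
    by rewrite mulr_ge0 ?sqr_ge0// divr_ge0// ltW// mulr_gt0.
  by field; rewrite gt_eqF.
have i2 := integrableZl mD (K / (2 * t)) sqi.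
rewrite RintegralD//; last exact: ci.
rewrite Rintegral_cst// RintegralZl//.
have hk' : \int[mu]_(x in D) ((f_ k x - f x) ^+ 2) <= t ^+ 2.
  rewrite -lee_fin /Rintegral fineK; first exact: ltW.
  exact: (integrable_fin_num mD sqi).
apply: (@le_trans _ _ (K * t / 2 * m + K / (2 * t) * t ^+ 2)).
  rewrite lerD2l ler_wpM2l// divr_ge0// ?mulr_ge0// ltW//.
have -> : K / (2 * t) * t ^+ 2 = K * t / 2 by field; rewrite gt_eqF.
by have := mulr_gt0 K0 t0; nra.
Qed.

Lemma L2_cvg_same_error {d} {T : measurableType d} {R : realType}
    {mu : {measure set T -> \bar R}} {D : set T} {f_ g_ : nat -> T -> R}
    {f g : T -> R} :
  (forall k x, g_ k x - g x = f_ k x - f x) ->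
  L2_cvg mu D f_ f -> L2_cvg mu D g_ g.
Proof.
move=> E; rewrite /L2_cvg.
suff -> : (fun k => \int[mu]_(x in D) ((g_ k x - g x) ^+ 2)%:E)%E =
    (fun k => \int[mu]_(x in D) ((f_ k x - f x) ^+ 2)%:E)%E by [].
by apply/funext => k; apply: eq_integral => x _; rewrite E.
Qed.

(** * Continuous functions on the plane *)

(** The Borel sets of the plane and the product sigma-algebra agree because an
open set is the union of the squares with rational centre and radius that it
contains. *)
Lemma open_measurable_plane {R : realType} (A : set (R * R)) :
  open A -> measurable A.
Proof.
move=> oA.
pose box (p q r : rat) : set (R * R) :=
  ball (ratr p : R) (ratr r : R) `*` ball (ratr q : R) (ratr r : R).
pose F p q r := if `[< box p q r `<=` A >] then box p q r else set0.
have -> : A = \bigcup_p \bigcup_q \bigcup_r F p q r.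
  apply/seteqP; split=> [[x y] Axy|z [p _ [q _ [r _]]]]; last first.
    by rewrite /F; case: asboolP => [sub zb|_ []]; exact: sub.
  move: oA => /(_ _ Axy) /nbhs_ballP[e /= e0 eA].
  have [r] : exists r : rat, ratr r \in `]0, e / 2[%R.
    by apply: rat_in_itvoo; rewrite divr_gt0.
  rewrite in_itv/= => /andP[r0 re].
  have near_rat (t : R) : exists p : rat, ball (ratr p : R) (ratr r) t.
    have [p] : exists p : rat, ratr p \in `]t - ratr r, t + ratr r[%R.
      by apply: rat_in_itvoo; lra.
    rewrite in_itv/= => pt; exists p; rewrite /ball/= ltr_norml; lra.
  have [p pxr] := near_rat x; have [q qyr] := near_rat y.
  exists p => //; exists q => //; exists r => //.
  rewrite /F; case: asboolP => [_|nA]; first by split.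
  exfalso; apply: nA => -[x' y'] [/= pxr' qyr'].
  apply: eA; split => /=.
  - apply: (@le_ball _ _ _ (ratr r + ratr r)); first lra.
    by apply: ball_triangle pxr'; exact: ball_sym.
  - apply: (@le_ball _ _ _ (ratr r + ratr r)); first lra.
    by apply: ball_triangle qyr'; exact: ball_sym.
apply: bigcupT_measurable_rat => p; apply: bigcupT_measurable_rat => q.
apply: bigcupT_measurable_rat => r; rewrite /F; case: ifP => // _.
by rewrite /box !ball_itv; apply: measurableX; exact: measurable_itv.
Qed.

Lemma continuous_measurable_plane {R : realType} (f : R * R -> R) :
  continuous f -> measurable_fun setT f.
Proof.
move=> /continuousP cf; apply: (measurability _ (RGenOpens.measurableE R)).
move=> _ [_ [a [b ->] <-]]; rewrite setTI; apply: open_measurable_plane.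
exact/cf/interval_open.
Qed.

Lemma leb2_rect {R : realType} (a b c d : R) : a <= b -> c <= d ->
  leb2 (`]a, b[ `*` `]c, d[ : set (R * R)) = ((b - a) * (d - c))%:E.
Proof.
move=> ab cd; rewrite /leb2 product_measure1E//.
have len (x y : R) : x <= y -> lebesgue_measure `]x, y[ = (y - x)%:E.
  move=> xy; rewrite lebesgue_measure_itv/= lte_fin.
  case: ltP => // yx; have -> : x = y by apply/eqP; rewrite eq_le xy yx.
  by rewrite subrr.
by rewrite [X in (X * _)%E]len// [X in (_ * X)%E]len.
Qed.

Lemma continuous_bounded_rect {R : realType} {a b c d : R} {f : R * R -> R} :
  continuous f -> [bounded f x | x in (`]a, b[ `*` `]c, d[ : set (R * R))].
Proof.
move=> cf; have cK : compact (`[a, b] `*` `[c, d] : set (R * R)).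
  by apply: compact_setX; exact: segment_compact.
have /compact_bounded[M [_ hM]] :=
  continuous_compact (continuous_subspaceT cf) cK.
exists M; split; rewrite ?num_real // => N MN x [/= x1 x2]; apply: (hM _ MN).
by exists x => //; split; apply: subset_itv_oo_cc.
Qed.

Lemma measurable_rect {R : realType} {a b c d : R} :
  measurable (`]a, b[ `*` `]c, d[ : set (R * R)).
Proof. by apply: measurableX; exact: measurable_itv. Qed.

Lemma continuous_integrable_rect {R : realType} {a b c d : R} {f : R * R -> R} :
  a <= b -> c <= d -> continuous f ->
  leb2.-integrable (`]a, b[ `*` `]c, d[) (EFin \o f).
Proof.
move=> ab cd cf; apply: measurable_bounded_integrable.
- exact: measurable_rect.
- have fin : (leb2 (`]a, b[ `*` `]c, d[ : set (R * R)) < +oo)%E.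
    by rewrite leb2_rect// ltry.
  exact: fin.
- exact: measurable_funTS (continuous_measurable_plane _ cf).
- exact: continuous_bounded_rect.
Qed.

(** The difference quotients of [f] in the direction [x2] are those of its
restriction to a vertical line. *)
Lemma slice_is_derive {R : realType} (f : R * R -> R) (s y : R) :
  derivable f (s, y) (coord_dir 1) ->
  is_derive y (1 : R) (fun y => f (s, y)) (partial 1 f (s, y)).
Proof.
move=> df.
have E : (fun h : R => h^-1 *: (((fun y => f (s, y)) \o shift y) (h *: (1 : R)) - f (s, y)))
    = (fun h : R => h^-1 *: ((f \o shift (s, y)) (h *: coord_dir 1) - f (s, y))).
  apply/funext => h; congr (_ *: (f _ - _)) => /=.
  by rewrite /shift/=; congr pair; rewrite /= ?scaler0 ?add0r.
split; first by rewrite /derivable E.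
by rewrite /derive E.
Qed.

Lemma continuous_along {R : realType} {f : R * R -> R} {p q : R -> R} :
  continuous f -> continuous p -> continuous q ->
  continuous (fun t => f (p t, q t)).
Proof.
move=> cf cp cq t.
apply: (continuous_comp (f := fun t => (p t, q t)) (g := f)); last exact: cf.
exact: (@cvg_pair _ _ _ (nbhs t) (nbhs (p t)) (nbhs (q t)) _ _ _ _ _ (cp t) (cq t)).
Qed.

Lemma slice_continuous {R : realType} {f : R * R -> R} (s : R) :
  continuous f -> continuous (fun y => f (s, y)).
Proof.
by move=> cf; apply: continuous_along => // y; [exact: cvg_cst|exact: cvg_id].
Qed.

(** The integrand is the derivative of [(a + b y) f(s, y)]. *)
Lemma slice_FTC {R : realType} (f : R * R -> R) (g a b s : R) : 0 < g ->
  (forall x, derivable f x (coord_dir 1)) ->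
  continuous f -> continuous (partial 1 f) ->
  (\int[lebesgue_measure]_(y in `]0%R, g[)
     (b * f (s, y) + (a + b * y) * partial 1 f (s, y))%:E =
   ((a + b * g) * f (s, g) - a * f (s, 0))%:E)%E.
Proof.
move=> g0 df cf cdf.
pose F y := (a + b * y) * f (s, y).
pose h y := b * f (s, y) + (a + b * y) * partial 1 f (s, y).
have aff : continuous (fun y : R => a + b * y).
  by move=> y; apply: cvgD; [exact: cvg_cst|apply: cvgM; [exact: cvg_cst|exact: cvg_id]].
have ch : continuous h.
  move=> y; apply: cvgD.
    by apply: cvgM; [exact: cvg_cst|exact: slice_continuous].
  by apply: cvgM; [exact: aff|exact: slice_continuous].
have dF (y : R) : is_derive y (1 : R) F (h y).
  have := slice_is_derive f s y (df _) => dfy.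
  have d1 : is_derive y (1 : R) (fun y : R => a + b * y) b.
    by apply: is_derive_eq; rewrite add0r mul1r /GRing.scale/= mulr1.
  apply: (is_derive_eq (is_deriveM d1 dfy)).
  by rewrite /GRing.scale/= addrC [f _ * b]mulrC.
have cF : continuous F.
  by move=> y; apply: cvgM; [exact: aff|exact: slice_continuous].
rewrite -(@integral_itv_bndoo _ 0 g _ true false); last first.
  apply/measurable_EFinP; apply: measurable_funTS.
  exact: continuous_measurable_fun.
rewrite (@continuous_FTC2 _ h F 0 g)//.
- by rewrite /F mulr0 addr0.
- exact: continuous_subspaceT.
- split.
  + by move=> y _; have [] := dF y.
  + exact: cvg_at_right_filter (cF 0).
  + exact: cvg_at_left_filter (cF g).
- by move=> y _; rewrite derive1E; have [_ ->] := dF y.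
Qed.

(** The affine weight can be made to vanish on the top or on the bottom side,
which expresses the integral of [f] along the other side by an integral over the
rectangle, a quantity that is continuous for the [H^1] convergence. *)
Lemma green_C1 {R : realType} (f : R * R -> R) (e g a b : R) : 0 < e -> 0 < g ->
  (forall x, derivable f x (coord_dir 1)) ->
  continuous f -> continuous (partial 1 f) ->
  \int[leb2]_(x in `]0, e[ `*` `]0, g[)
     (b * f x + (a + b * x.2) * partial 1 f x) =
  \int[lebesgue_measure]_(s in `]0, e[) ((a + b * g) * f (s, g) - a * f (s, 0)).
Proof.
move=> e0 g0 df cf cdf.
pose h x := b * f x + (a + b * x.2) * partial 1 f x.
have ch : continuous h.
  move=> x; apply: cvgD; first by apply: cvgM; [exact: cvg_cst|exact: cf].
  apply: cvgM; last exact: cdf.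
  apply: cvgD; first exact: cvg_cst.
  apply: cvgM; first exact: cvg_cst.
  by apply: cvg_snd.
have hi := continuous_integrable_rect (ltW e0) (ltW g0) ch.
rewrite /Rintegral; congr fine.
rewrite integral_mkcond -(integral12_prod_meas1 (m1 := lebesgue_measure) (m2 := lebesgue_measure)); last first.
  have mrect : measurable (`]0, e[ `*` `]0, g[ : set (R * R)).
    exact: measurable_rect.
  have := (integrable_mkcond (mu := leb2) (EFin \o h) mrect).1 hi.
  exact.
rewrite [RHS]integral_mkcond; apply: eq_integral => s _.
rewrite /fubini_F patchE; case: ifPn => se.
  rewrite -(slice_FTC f)// [RHS]integral_mkcond; apply: eq_integral => y _.
  rewrite !patchE; congr (if _ then _ else _).
  by rewrite in_setX se.
rewrite integral0_eq// => y _; rewrite patchE in_setX (negbTE se).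
by [].
Qed.

(** * Geometry of the micro-domain *)

Lemma lipschitz_continuous {R : realType} {f : R -> R} :
  lipschitz f -> continuous f.
Proof.
move=> /pinfty_ex_gt0[K K0 hK] x.
apply/cvgrPdist_lt => e e0; near=> y.
have hxy : `|f x - f y| <= K * `|x - y| by exact: (hK (x, y)).
apply: (le_lt_trans hxy); rewrite mulrC -ltr_pdivlMr//.
near: y; apply: (@cvgr_dist_lt _ _ _ _ _ id x); first exact: cvg_id.
by rewrite divr_gt0.
Unshelve. all: by end_near. Qed.

Lemma profile_le_height {R : realType} {phi : R -> R} (s : R) :
  rough_profile phi -> phi s <= profile_height phi.
Proof.
move=> h; apply: (le_trans (ler_norm _)); apply: ub_le_sup; last by exists s.
have [M [_ hM]] := profile_bounded h; exists (M + 1) => _ [t _ <-].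
by apply: hM => //; rewrite ltrDl.
Qed.

Lemma rough_graph_range {R : realType} {phi : R -> R} {e : R} (s : R) :
  rough_profile phi -> 0 < e ->
  - roughM phi e <= rough_graph phi e s <= 0.
Proof.
move=> h e0; rewrite /rough_graph subr_le0 /roughM ler_pM2l//.
by rewrite profile_le_height// andbT lerDr mulr_ge0 ?(ltW e0)// (profile_ge0 h).
Qed.

Lemma rough_graph_continuous {R : realType} {phi : R -> R} (e : R) :
  rough_profile phi -> continuous (rough_graph phi e).
Proof.
move=> h s; apply: cvgB; last exact: cvg_cst.
apply: cvgM; first exact: cvg_cst.
apply: continuous_cvg; first exact: lipschitz_continuous (profile_lipschitz h) _.
by apply: cvgM; [exact: cvg_id|exact: cvg_cst].
Qed.

Lemma measurable_micro_domain {R : realType} {phi : R -> R} (e g : R) :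
  rough_profile phi -> measurable (micro_domain phi e g).
Proof.
move=> h.
have -> : micro_domain phi e g = (`]0, e[ `*` `]-oo, g[) `&`
    ((fun x : R * R => x.2 - rough_graph phi e x.1) @^-1` `]0, +oo[).
  apply/seteqP; split=> [x [x0 xe xr xg]|x [[/= + +] +]] /=.
    by rewrite !in_itv/= !andbT subr_gt0 x0 xe xr xg.
  by rewrite !in_itv/= !andbT subr_gt0 => /andP[x0 xe] xg xr; split.
apply: measurableI; first by apply: measurableX; exact: measurable_itv.
rewrite -[X in measurable X]setTI; apply: continuous_measurable_plane => //.
move=> x; apply: cvgB; first exact: cvg_snd.
apply: continuous_cvg; [exact: rough_graph_continuous|exact: cvg_fst].
Qed.

Lemma upper_rect_sub {R : realType} {phi : R -> R} {e : R} (g : R) :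
  rough_profile phi -> 0 < e ->
  `]0, e[ `*` `]0, g[ `<=` micro_domain phi e g.
Proof.
move=> h e0 x [/=]; rewrite !in_itv/= => /andP[x0 xe] /andP[y0 yg].
split => //; apply: le_lt_trans y0.
by have /andP[] := rough_graph_range x.1 h e0.
Qed.

Lemma micro_domain_sub {R : realType} {phi : R -> R} {e : R} (g : R) :
  rough_profile phi -> 0 < e ->
  micro_domain phi e g `<=` `]0, e[ `*` `]- roughM phi e, g[.
Proof.
move=> h e0 x [x0 xe xr xg]; rewrite /= !in_itv/= x0 xe xg andbT; split => //.
rewrite andbT; apply: le_lt_trans xr; by have /andP[] := rough_graph_range x.1 h e0.
Qed.

Lemma roughM_ge0 {R : realType} {phi : R -> R} {e : R} :
  rough_profile phi -> 0 < e -> 0 <= roughM phi e.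
Proof. by move=> h e0; rewrite mulr_ge0// ltW// profile_height_gt0. Qed.

Lemma micro_domain_area {R : realType} {phi : R -> R} {e g : R} :
  rough_profile phi -> 0 < e -> 0 < g ->
  (leb2 (micro_domain phi e g) <= (e * (g + roughM phi e))%:E)%E.
Proof.
move=> h e0 g0; have M0 := roughM_ge0 h e0.
have := @leb2_rect _ 0 e (- roughM phi e) g (ltW e0).
rewrite subr0 opprK => <-; last by lra.
rewrite /leb2 le_measure ?inE//.
- exact: measurable_micro_domain.
- exact: measurable_rect.
- exact: micro_domain_sub.
Qed.

Lemma micro_domain_finite {R : realType} {phi : R -> R} {e g : R} :
  rough_profile phi -> 0 < e -> 0 < g ->
  (leb2 (micro_domain phi e g) < +oo)%E.
Proof.
by move=> h e0 g0; apply: le_lt_trans (micro_domain_area h e0 g0) (ltry _).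
Qed.

Lemma continuous_square_integrable {R : realType} {phi : R -> R} {e g : R}
    {f : R * R -> R} :
  rough_profile phi -> 0 < e -> 0 < g -> continuous f ->
  square_integrable leb2 (micro_domain phi e g) f.
Proof.
move=> h e0 g0 cf; have M0 := roughM_ge0 h e0.
have mf := continuous_measurable_plane _ cf.
have big : square_integrable leb2 (`]0, e[ `*` `]- roughM phi e, g[) f.
  split; first exact: measurable_funTS.
  have cf2 : continuous (fun x => f x ^+ 2) by move=> x; apply: cvgM; exact: cf.
  have : leb2.-integrable (`]0, e[ `*` `]- roughM phi e, g[)
      (EFin \o (fun x => f x ^+ 2)).
    by apply: continuous_integrable_rect => //; [exact: ltW|lra].
  move=> /integrableP[_]; apply: le_lt_trans; rewrite le_eqVlt; apply/orP; left.
  by apply/eqP; apply: eq_integral => x _; rewrite /= ger0_norm ?sqr_ge0.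
apply: square_integrableS big.
- exact: measurable_rect.
- exact: measurable_micro_domain.
- exact: micro_domain_sub.
Qed.

(** * Traces of periodic Sobolev functions *)

Lemma continuous_affine_height {R : realType} (a b : R) :
  continuous (fun x : R * R => a + b * x.2).
Proof.
move=> x; apply: cvgD; first exact: cvg_cst.
by apply: cvgM; [exact: cvg_cst|exact: cvg_snd].
Qed.

Lemma line_integrable {R : realType} {e : R} {f : R -> R} : continuous f ->
  lebesgue_measure.-integrable `]0, e[ (EFin \o f).
Proof.
move=> cf; have ci : lebesgue_measure.-integrable `[0, e] (EFin \o f).
  apply: continuous_compact_integrable; first exact: segment_compact.
  exact: continuous_subspaceT.
by apply: integrableS ci => //; exact: subset_itv_oo_cc.
Qed.

Lemma line_finite {R : realType} (e : R) :
  (lebesgue_measure (`]0%R, e[ : set R) < +oo)%E.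
Proof. by rewrite lebesgue_measure_itv/=; case: ifP => // _; rewrite ltry. Qed.

(** The traces at two heights may be obtained from different approximating
sequences.  This formula depends on the pair [(u, du)] alone, so it makes
them comparable.  The condition on [F] says that the boundary terms of
[green_C1] reduce to the value at height [c]: either [c = g] and the weight is 1
there and 0 at the bottom, or [c = 0] and it is 0 at the top and [-1] at the
bottom. *)
Lemma trace_green {R : realType} {phi : R -> R} {e g : R} {u : R * R -> R}
    {du : 'I_2 -> R * R -> R} {c : R} {t : R -> R} (a b : R) :
  rough_profile phi -> 0 < e -> 0 < g ->
  H1_periodic phi e g u du -> H1_trace phi e g u du (cst c) t ->
  (forall F : R -> R, (a + b * g) * F g - a * F 0 = F c) ->
  \int[lebesgue_measure]_(s in `]0, e[) t s =
  \int[leb2]_(x in `]0, e[ `*` `]0, g[) (b * u x + (a + b * x.2) * du 1 x).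
Proof.
move=> h e0 g0 [ui dui _] [ti [f_ [[f_C1 cvu cvdu] cvt]]] hab.
have mO := measurable_micro_domain e g h.
have mrect : measurable (`]0, e[ `*` `]0, g[ : set (R * R)).
  exact: measurable_rect.
have sub := upper_rect_sub g h e0.
have frect : (leb2 (`]0%R, e[ `*` `]0%R, g[ : set (R * R)) < +oo)%E.
  by rewrite leb2_rect ?ltW// ltry.
have cf k : continuous (f_ k) by have [] := f_C1 k.
have cdf k : continuous (partial 1 (f_ k)).
  by have [_ _ /(_ 1)] := f_C1 k.
have df k x : derivable (f_ k) x (coord_dir 1).
  by have [/(_ 1)] := f_C1 k.
have ur := square_integrableS (mu := leb2) mO mrect sub ui.
have dur := square_integrableS (mu := leb2) mO mrect sub (dui 1).
have cu : L2_cvg leb2 (`]0, e[ `*` `]0, g[) f_ u.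
  apply: (L2_cvg_subset (mu := leb2) mO mrect sub _ ui.1 cvu) => k.
  exact: measurable_funTS (continuous_measurable_plane _ (cf k)).
have cdu : L2_cvg leb2 (`]0, e[ `*` `]0, g[) (fun k => partial 1 (f_ k)) (du 1).
  apply: (L2_cvg_subset (mu := leb2) mO mrect sub _ (dui 1).1 (cvdu 1)) => k.
  exact: measurable_funTS (continuous_measurable_plane _ (cdf k)).
pose p : R * R -> R := fun x => a + b * x.2.
have cp : continuous p := continuous_affine_height a b.
have mp : measurable_fun (`]0, e[ `*` `]0, g[) p.
  exact: measurable_funTS (continuous_measurable_plane _ cp).
have bp : [bounded p x | x in (`]0, e[ `*` `]0, g[ : set (R * R))].
  exact: continuous_bounded_rect.
have bb : [bounded (cst b : R * R -> R) x | x in (`]0, e[ `*` `]0, g[ : set (R * R))].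
  by apply: continuous_bounded_rect => x; exact: cvg_cst.
have ifk k := continuous_integrable_rect (ltW e0) (ltW g0) (cf k).
have idfk k := continuous_integrable_rect (ltW e0) (ltW g0) (cdf k).
have L1 := L2_cvg_Rintegral (mu := leb2) mrect frect (@measurable_cst _ _ _ _ _ b) bb ifk ur cu.
have L2 := L2_cvg_Rintegral (mu := leb2) mrect frect mp bp idfk dur cdu.
have iu : leb2.-integrable (`]0, e[ `*` `]0, g[) (EFin \o (fun x => b * u x)).
  have := integrableZl (mu := leb2) mrect b (square_integrable_integrable (mu := leb2) mrect frect ur).
  by apply: eq_integrable.
have idu : leb2.-integrable (`]0, e[ `*` `]0, g[) (EFin \o (fun x => p x * du 1 x)).
  have := integrableMr (mu := leb2) mrect mp bp (square_integrable_integrable (mu := leb2) mrect frect dur).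
  by apply: eq_integrable.
rewrite RintegralD//.
have Lt : \int[lebesgue_measure]_(s in `]0, e[) (1 * f_ k (s, c)) @[k --> \oo] -->
    \int[lebesgue_measure]_(s in `]0, e[) (1 * t s).
  apply: (L2_cvg_Rintegral (h := cst 1) _ _ _ _ _ ti cvt) => //.
  - exact: line_finite.
  - by exists 1; split => // M M1 x _; rewrite /= normr1; exact: ltW.
  - move=> k; apply: line_integrable; apply: continuous_along => // s.
      exact: cvg_id.
    exact: cvg_cst.
have E : (fun k => \int[lebesgue_measure]_(s in `]0, e[) (1 * f_ k (s, c))) =
    (fun k => \int[leb2]_(x in `]0, e[ `*` `]0, g[) (b * f_ k x) +
              \int[leb2]_(x in `]0, e[ `*` `]0, g[) (p x * partial 1 (f_ k) x)).
  apply/funext => k; rewrite -RintegralD//; last 2 first.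
  - have := integrableZl (mu := leb2) mrect b (ifk k); by apply: eq_integrable.
  - have := integrableMr (mu := leb2) mrect mp bp (idfk k); by apply: eq_integrable.
  rewrite (green_C1 (f_ k) e g a b e0 g0 (df k) (cf k) (cdf k)).
  by apply: eq_Rintegral => s _; rewrite (hab (fun y => f_ k (s, y))) mul1r.
transitivity (\int[lebesgue_measure]_(s in `]0, e[) (1 * t s)).
  by apply: eq_Rintegral => s _; rewrite mul1r.
rewrite E in Lt; exact: (cvg_unique (@Rhausdorff R) Lt (cvgD L1 L2)).
Qed.

(** Weights [x2 / g] and [x2 / g - 1] in [trace_green]; they differ by 1 and
have the same slope, so the terms in [u] cancel. *)
Lemma trace_flux {R : realType} {phi : R -> R} {e g : R} {u : R * R -> R}
    {du : 'I_2 -> R * R -> R} {t0 tg : R -> R} :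
  rough_profile phi -> 0 < e -> 0 < g -> H1_periodic phi e g u du ->
  H1_trace phi e g u du (cst 0) t0 -> H1_trace phi e g u du (cst g) tg ->
  \int[lebesgue_measure]_(s in `]0, e[) tg s -
  \int[lebesgue_measure]_(s in `]0, e[) t0 s =
  \int[leb2]_(x in `]0, e[ `*` `]0, g[) du 1 x.
Proof.
move=> h e0 g0 hu ht0 htg; have [ui dui _] := hu.
have mO := measurable_micro_domain e g h.
have mrect : measurable (`]0, e[ `*` `]0, g[ : set (R * R)).
  exact: measurable_rect.
have sub := upper_rect_sub g h e0.
have frect : (leb2 (`]0%R, e[ `*` `]0%R, g[ : set (R * R)) < +oo)%E.
  by rewrite leb2_rect ?ltW// ltry.
have iu := square_integrable_integrable (mu := leb2) mrect frect
  (square_integrableS (mu := leb2) mO mrect sub ui).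
have idu := square_integrable_integrable (mu := leb2) mrect frect
  (square_integrableS (mu := leb2) mO mrect sub (dui 1)).
have I a b : leb2.-integrable (`]0, e[ `*` `]0, g[)
    (EFin \o (fun x => b * u x + (a + b * x.2) * du 1 x)).
  have cp := continuous_affine_height a b.
  have mp : measurable_fun (`]0, e[ `*` `]0, g[) (fun x : R * R => a + b * x.2).
    exact: measurable_funTS (continuous_measurable_plane _ cp).
  have bp := @continuous_bounded_rect _ 0 e 0 g _ cp.
  have := integrableD (mu := leb2) mrect (integrableZl (mu := leb2) mrect b iu) (integrableMr (mu := leb2) mrect mp bp idu).
  by apply: eq_integrable.
rewrite (trace_green 0 g^-1 h e0 g0 hu htg); last first.
  by move=> F; rewrite add0r mulVf ?gt_eqF// mul1r mul0r subr0.
rewrite (trace_green (-1) g^-1 h e0 g0 hu ht0); last first.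
  by move=> F; rewrite mulVf ?gt_eqF// addNr mul0r add0r mulN1r opprK.
rewrite -RintegralB//; apply: eq_Rintegral => x _; ring.
Qed.

(** * Energy of the flows *)

Lemma C1_periodicB {R : realType} {e : R} {f w : R * R -> R} :
  C1_periodic e f -> C1_periodic e w ->
  C1_periodic e (fun x => f x - w x) /\
  forall j x, partial j (fun x => f x - w x) x = partial j f x - partial j w x.
Proof.
move=> [df cf cdf pf] [dw cw cdw pw].
have pB j x : partial j (fun x => f x - w x) x = partial j f x - partial j w x.
  exact: (deriveB (df j x) (dw j x)).
split; last exact: pB.
split.
- by move=> j x; exact: (derivableB (df j x) (dw j x)).
- by move=> x; apply: cvgB; [exact: cf|exact: cw].
- move=> j; rewrite (_ : partial j _ = fun x => partial j f x - partial j w x).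
    by move=> x; apply: cvgB; [exact: cdf|exact: cdw].
  by apply/funext => x; exact: pB.
- by move=> x; rewrite pf pw.
Qed.

Lemma H1_approxB {R : realType} {phi : R -> R} {e g : R} {f_ : nat -> R * R -> R}
    {f w : R * R -> R} {df : 'I_2 -> R * R -> R} :
  H1_approx phi e g f_ f df -> C1_periodic e w ->
  H1_approx phi e g (fun k x => f_ k x - w x) (fun x => f x - w x)
    (fun j x => df j x - partial j w x).
Proof.
move=> [fC cf cdf] hw; split.
- by move=> k; have [] := C1_periodicB (fC k) hw.
- by apply: L2_cvg_same_error cf => k x; ring.
- move=> j; apply: L2_cvg_same_error (cdf j) => k x.
  by rewrite (C1_periodicB (fC k) hw).2; ring.
Qed.

Lemma H1_periodicB {R : realType} {phi : R -> R} {e g : R}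
    {f w : R * R -> R} {df : 'I_2 -> R * R -> R} :
  rough_profile phi -> 0 < e -> 0 < g ->
  H1_periodic phi e g f df -> C1_periodic e w ->
  H1_periodic phi e g (fun x => f x - w x) (fun j x => df j x - partial j w x).
Proof.
move=> h e0 g0 [fi dfi [f_ hf]] hw; have [_ cw cdw _] := hw.
have mO := measurable_micro_domain e g h.
split.
- apply: (square_integrableB (mu := leb2)) => //.
  exact: continuous_square_integrable.
- move=> j; apply: (square_integrableB (mu := leb2)) => //.
  exact: continuous_square_integrable.
- by exists (fun k x => f_ k x - w x); exact: H1_approxB.
Qed.

(** Subtracting a [C^1] field with the same boundary values produces a field
with zero trace, by translation of the approximating sequence. *)
Lemma H1_traceB {R : realType} {phi : R -> R} {e g : R}
    {f w : R * R -> R} {df : 'I_2 -> R * R -> R} {c t : R -> R} :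
  H1_trace phi e g f df c t -> C1_periodic e w ->
  (forall s, t s = w (s, c s)) ->
  H1_trace phi e g (fun x => f x - w x) (fun j x => df j x - partial j w x)
    c (cst 0).
Proof.
move=> [ti [f_ [hf ct]]] hw tE; split.
  apply: square_integrable_cst; first exact: measurable_itv.
  exact: line_finite.
exists (fun k x => f_ k x - w x); split; first exact: H1_approxB.
by apply: L2_cvg_same_error ct => k s; rewrite /= tE; ring.
Qed.

Lemma vertical_is_derive {R : realType} {W W' : R -> R} (j : 'I_2) (x : R * R) :
  (forall y, is_derive y (1 : R) W (W' y)) ->
  is_derive x (coord_dir j) (fun x => W x.2) (if j == 1 then W' x.2 else 0).
Proof.
move=> dW; case: ifPn => j1.
  have E : (fun h : R => h^-1 *: (((fun x => W x.2) \o shift x) (h *: coord_dir j) - W x.2))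
      = (fun h : R => h^-1 *: ((W \o shift x.2) (h *: (1 : R)) - W x.2)).
    by apply/funext => h; rewrite /shift/= j1.
  have [dx <-] := dW x.2.
  by split; rewrite /derivable /derive E.
have E : (fun h : R => h^-1 *: (((fun x => W x.2) \o shift x) (h *: coord_dir j) - W x.2))
    = cst 0.
  by apply/funext => h; rewrite /shift/= (negbTE j1) scaler0 add0r subrr scaler0.
split; first by rewrite /derivable E; exact: is_cvg_cst.
by rewrite /derive E; apply: lim_cst.
Qed.

Lemma e1_vertical_partial {R : realType} {W W' : R -> R} (i j : 'I_2) (x : R * R) :
  (forall y, is_derive y (1 : R) W (W' y)) ->
  is_derive x (coord_dir j) (e1_field (fun x => W x.2) i)
    (if (i == 0) && (j == 1) then W' x.2 else 0).
Proof.
move=> dW; case: (eqVneq i 0) => [->|i0].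
  rewrite (_ : e1_field _ _ = fun x => W x.2); last first.
    by apply/funext => y; rewrite /e1_field eqxx.
  exact: vertical_is_derive.
rewrite (_ : e1_field _ _ = cst 0); last first.
  by apply/funext => y; rewrite /e1_field (negbTE i0).
exact: is_derive_cst.
Qed.

Lemma continuous_vertical {R : realType} {W : R -> R} :
  continuous W -> continuous (fun x : R * R => W x.2).
Proof.
move=> cW x; apply: (continuous_comp (f := @snd R R) (g := W)).
  exact: cvg_snd.
exact: cW.
Qed.

Lemma e1_vertical_C1 {R : realType} {W W' : R -> R} (e : R) (i : 'I_2) :
  (forall y, is_derive y (1 : R) W (W' y)) -> continuous W' ->
  C1_periodic e (e1_field (fun x => W x.2) i).
Proof.
move=> dW cW'; have cW : continuous W.
  move=> y; apply: differentiable_continuous; apply/derivable1_diffP.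
  by have [] := dW y.
split.
- by move=> j x; have [] := e1_vertical_partial i j x dW.
- rewrite /e1_field; case: (i == 0); last by move=> x; exact: cvg_cst.
  exact: continuous_vertical.
- move=> j; rewrite (_ : partial _ _ = fun x : R * R => if (i == 0) && (j == 1) then W' x.2 else 0).
    case: andP => _; last by move=> x; exact: cvg_cst.
    exact: continuous_vertical.
  apply/funext => x; rewrite /partial.
  by have [_ ->] := e1_vertical_partial i j x dW.
- by move=> [x y].
Qed.

(** Testing the momentum equation with [v = u - W e1], which is divergence free
and vanishes on both boundaries, kills the pressure and leaves
[int (grad u . grad v) = 0].  Pointwise [2 (grad u . grad v)] is at least
[(d u_1 / d x2)^2 - W'^2]. *)
Lemma dirichlet_energy_le {R : realType} {phi : R -> R} {e g : R}
    {b t : 'I_2 -> R * R -> R} {u : 'I_2 -> R * R -> R}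
    {du : 'I_2 -> 'I_2 -> R * R -> R} {p : R * R -> R} {W W' : R -> R} :
  rough_profile phi -> 0 < e -> 0 < g -> stokes_flow phi e g b t u du p ->
  (forall y, is_derive y (1 : R) W (W' y)) -> continuous W' ->
  (forall i s, b i (s, rough_graph phi e s) =
     e1_field (fun x => W x.2) i (s, rough_graph phi e s)) ->
  (forall i s, t i (s, g) = e1_field (fun x => W x.2) i (s, g)) ->
  \int[leb2]_(x in micro_domain phi e g) (du 0 1 x ^+ 2) <=
  \int[leb2]_(x in micro_domain phi e g) (W' x.2 ^+ 2).
Proof.
move=> h e0 g0 [uH pL ubot utop udiv umom] dW cW' hb ht.
set O := micro_domain phi e g.
have mO : measurable O := measurable_micro_domain e g h.
have finO : (leb2 O < +oo)%E := micro_domain_finite h e0 g0.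
pose w i := e1_field (fun x : R * R => W x.2) i.
have wC i : C1_periodic e (w i) := e1_vertical_C1 e i dW cW'.
have pwE i j x : partial j (w i) x = if (i == 0) && (j == 1) then W' x.2 else 0.
  by rewrite /partial; have [_ ->] := e1_vertical_partial i j x dW.
pose dv i j x := du i j x - partial j (w i) x.
have := umom (fun i x => u i x - w i x) dv.
have adm i : [/\ H1_periodic phi e g (fun x => u i x - w i x) (dv i),
    H1_trace phi e g (fun x => u i x - w i x) (dv i) (rough_graph phi e) (cst 0)
  & H1_trace phi e g (fun x => u i x - w i x) (dv i) (cst g) (cst 0)].
  split; first exact: H1_periodicB.
  - exact: H1_traceB (ubot i) (wC i) (hb i).
  - exact: H1_traceB (utop i) (wC i) (ht i).
move=> /(_ adm).
have sdu i j : square_integrable leb2 O (du i j) by have [_ + _] := uH i; apply.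
have sdv i j : square_integrable leb2 O (dv i j).
  by have [[_ + _] _ _] := adm i; apply.
have divv x : \sum_(i < 2) dv i i x = \sum_(i < 2) du i i x.
  apply: eq_bigr => i _; rewrite /dv pwE.
  case: (eqVneq i 0) => [->|i0] /=; last by rewrite subr0.
  by rewrite subr0.
have -> : \int[leb2]_(x in O) (p x * \sum_(i < 2) dv i i x) = 0.
  rewrite /Rintegral (ae_eq_integral (cst 0%E)) ?integral0//.
  - apply/measurable_EFinP; apply: measurable_funM; first exact: pL.1.
    by apply: measurable_sum => i; exact: (sdv i i).1.
  - have [N [mN N0 hN]] := udiv; exists N; split => //.
    apply: subset_trans hN => x /= nx hx; apply: nx => Ox.
    by rewrite divv hx// mulr0.
rewrite subr0 => en0.
have iprod i j := square_integrable_mul (mu := leb2) mO (sdu i j) (sdv i j).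
have isum : leb2.-integrable O
    (EFin \o (fun x => \sum_(i < 2) \sum_(j < 2) du i j x * dv i j x)).
  rewrite (_ : _ \o _ = fun x => (\sum_(i < 2) \sum_(j < 2) (du i j x * dv i j x)%:E)%E).
    apply: (integrable_sum (mu := leb2)) => // i _.
    by apply: (integrable_sum (mu := leb2)) => // j _; exact: iprod.
  by apply/funext => x; rewrite /= -sumEFin; apply: eq_bigr => i _; rewrite sumEFin.
have sW : square_integrable leb2 O (fun x : R * R => W' x.2).
  by apply: continuous_square_integrable => //; exact: continuous_vertical.
have iW : leb2.-integrable O (EFin \o (fun x : R * R => W' x.2 ^+ 2)) :=
  square_integrable_mul (mu := leb2) mO sW sW.
have idu : leb2.-integrable O (EFin \o (fun x => du 0 1 x ^+ 2)) :=
  square_integrable_mul (mu := leb2) mO (sdu 0 1) (sdu 0 1).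
rewrite -subr_le0 -RintegralB//.
have i2 : leb2.-integrable O
    (EFin \o (fun x => 2 * \sum_(i < 2) \sum_(j < 2) du i j x * dv i j x)).
  have := integrableZl (mu := leb2) mO 2 isum; by apply: eq_integrable.
apply: (@le_trans _ _ (\int[leb2]_(x in O)
    (2 * \sum_(i < 2) \sum_(j < 2) du i j x * dv i j x))); last first.
  by rewrite RintegralZl// en0 mulr0.
apply: le_Rintegral => //.
  have := integrableB (mu := leb2) mO idu iW; by apply: eq_integrable.
move=> x _.
(* Away from the entry (0, 1) the gradient of the shear vanishes, so the
   corresponding products are squares. *)
have other i j : (i == 0) && (j == 1) = false -> 0 <= du i j x * dv i j x.
  by move=> ij; rewrite /dv pwE ij subr0 -expr2 sqr_ge0.
rewrite (bigD1 0)//= (bigD1 1)//= {1}/dv pwE/=.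
set r1 := \sum_(j < 2 | _) _; set r2 := \sum_(i < 2 | _) _.
have r10 : 0 <= r1.
  by apply: sumr_ge0 => j /negbTE j1; apply: other; rewrite j1 andbF.
have r20 : 0 <= r2.
  apply: sumr_ge0 => i /negbTE i0; apply: sumr_ge0 => j _.
  by apply: other; rewrite i0.
have := sqr_ge0 (du 0 1 x - W' x.2).
by move: (du 0 1 x) (W' x.2) r10 r20 => a c; nra.
Qed.

(** By [trace_flux] the left-hand side is the integral of [d u_1 / d x2] over the
rectangle.  The inequality [|y| <= K / 2 + y^2 / (2 K)] splits it into two
halves, an area term and an energy term, each at most
[K e (g + M) / 2]. *)
Lemma line_integral_near_top {R : realType} {phi : R -> R} {e g : R}
    {b t : 'I_2 -> R * R -> R} {u : 'I_2 -> R * R -> R}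
    {du : 'I_2 -> 'I_2 -> R * R -> R} {p : R * R -> R} {W W' : R -> R} {B K : R} :
  rough_profile phi -> 0 < e -> 0 < g -> stokes_flow phi e g b t u du p ->
  is_line_integral phi e g u du B ->
  (forall y, is_derive y (1 : R) W (W' y)) -> continuous W' ->
  (forall i s, b i (s, rough_graph phi e s) =
     e1_field (fun x => W x.2) i (s, rough_graph phi e s)) ->
  (forall i s, t i (s, g) = e1_field (fun x => W x.2) i (s, g)) ->
  0 < K -> (forall y, - roughM phi e <= y <= g -> `|W' y| <= K) ->
  `|e * W g - B| <= K * e * (g + roughM phi e).
Proof.
move=> h e0 g0 flow [t0 trace0 ->] dW cW' hb ht K0 hK.
set O := micro_domain phi e g; set D := (`]0, e[ `*` `]0, g[ : set (R * R)).
have mO : measurable O := measurable_micro_domain e g h.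
have mD : measurable D := measurable_rect.
have finO : (leb2 O < +oo)%E := micro_domain_finite h e0 g0.
have finD : (leb2 D < +oo)%E by rewrite leb2_rect ?ltW// ltry.
have subDO : D `<=` O := upper_rect_sub g h e0.
have [_ sdu _] := flow_H1 flow 0.
have sO : square_integrable leb2 O (du 0 1) := sdu 1.
have sD : square_integrable leb2 D (du 0 1) :=
  square_integrableS (mu := leb2) mO mD subDO sO.
have iO2 : leb2.-integrable O (EFin \o (fun x => du 0 1 x ^+ 2)) :=
  square_integrable_mul (mu := leb2) mO sO sO.
have iD2 : leb2.-integrable D (EFin \o (fun x => du 0 1 x ^+ 2)) :=
  square_integrable_mul (mu := leb2) mD sD sD.
have iD : leb2.-integrable D (EFin \o du 0 1) :=
  square_integrable_integrable (mu := leb2) mD finD sD.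
have M0 := roughM_ge0 h e0.
have areaO : fine (leb2 O) <= e * (g + roughM phi e).
  rewrite -lee_fin fineK; first exact: micro_domain_area.
  by rewrite ge0_fin_numE.
have energyO : \int[leb2]_(x in O) (du 0 1 x ^+ 2) <= K ^+ 2 * (e * (g + roughM phi e)).
  apply: (le_trans (dirichlet_energy_le h e0 g0 flow dW cW' hb ht)).
  have icst : leb2.-integrable O (EFin \o cst (K ^+ 2)).
    apply: (square_integrable_integrable (mu := leb2)) => //.
    exact: square_integrable_cst.
  apply: (@le_trans _ _ (\int[leb2]_(x in O) (K ^+ 2))).
    apply: le_Rintegral => //.
      have sW : square_integrable leb2 O (fun x : R * R => W' x.2).
        by apply: continuous_square_integrable => //; exact: continuous_vertical.
      exact: (square_integrable_mul (mu := leb2) mO sW sW).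
    move=> x Ox; rewrite -(real_normK (num_real (W' _))) ler_sqr ?nnegrE ?(ltW K0)//.
    apply: hK; have [_ /=] := micro_domain_sub g h e0 x Ox.
    by rewrite in_itv/= => /andP[/ltW -> /ltW ->].
  by rewrite Rintegral_cst// ler_wpM2l// sqr_ge0.
have energyD : \int[leb2]_(x in D) (du 0 1 x ^+ 2) <= K ^+ 2 * (e * (g + roughM phi e)).
  apply: le_trans energyO; rewrite /Rintegral fine_le//.
  - exact: (integrable_fin_num (mu := leb2) mD iD2).
  - exact: (integrable_fin_num (mu := leb2) mO iO2).
  - apply: ge0_subset_integral => //.
    + exact: (measurable_int leb2 iO2).
    + by move=> x _; rewrite lee_fin sqr_ge0.
have topE : \int[lebesgue_measure]_(s in `]0, e[) t 0 (s, g) = e * W g.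
  under eq_Rintegral do rewrite ht /e1_field/=.
  have len : fine (lebesgue_measure (`]0, e[ : set R)) = e.
    by rewrite lebesgue_measure_itv/= lte_fin e0/= subr0.
  by rewrite Rintegral_cst// mulrC; congr (_ * _); exact: len.
rewrite -topE.
have := trace_flux h e0 g0 (flow_H1 flow 0) trace0 (flow_top flow 0).
move=> ->.
apply: (le_trans (le_normr_Rintegral (mu := leb2) mD iD)).
have icD : leb2.-integrable D (EFin \o cst (K / 2)).
  apply: (square_integrable_integrable (mu := leb2)) => //.
  exact: square_integrable_cst.
have isq : leb2.-integrable D (EFin \o (fun x => (2 * K)^-1 * du 0 1 x ^+ 2)).
  have := integrableZl (mu := leb2) mD ((2 * K)^-1) iD2; by apply: eq_integrable.
apply: (@le_trans _ _ (\int[leb2]_(x in D) (K / 2 + (2 * K)^-1 * du 0 1 x ^+ 2))).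
  apply: le_Rintegral => //.
  - by have := integrable_norm (mu := leb2) iD.
  - have := integrableD (mu := leb2) mD icD isq; by apply: eq_integrable.
  move=> x _; rewrite -(real_normK (num_real (du 0 1 x))); set y := `|_|.
  rewrite -subr_ge0 [leRHS](_ : _ = (2 * K)^-1 * (y - K) ^+ 2).
    by rewrite mulr_ge0 ?sqr_ge0// invr_ge0 mulr_ge0// ltW.
  by field; rewrite gt_eqF.
rewrite RintegralD// Rintegral_cst// RintegralZl//.
have areaD : fine (leb2 D) = e * g by rewrite leb2_rect ?ltW//= !subr0.
rewrite [X in K / 2 * X]areaD.
apply: (@le_trans _ _ (K / 2 * (e * g) + (2 * K)^-1 * (K ^+ 2 * (e * (g + roughM phi e))))).
  by rewrite lerD2l ler_wpM2l// invr_ge0 mulr_ge0// ltW.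
rewrite [X in _ + X](_ : _ = K / 2 * (e * (g + roughM phi e))); last first.
  by field; rewrite gt_eqF.
have : 0 <= K * (e * roughM phi e) by rewrite mulr_ge0 ?(ltW K0)// mulr_ge0 ?(ltW e0).
lra.
Qed.

(** * The line integrals and the limit *)

(** For every [h] the Taylor remainder of [y |y|] at [x] is at most [h^2], because
the derivative [2 |y|] is 2-Lipschitz. *)
Lemma is_derive_signed_square {R : realType} (x : R) :
  is_derive x (1 : R) (fun y => y * `|y|) (2 * `|x|).
Proof.
have bound (h : R) : `|2 * `|x| * h - ((h + x) * `|h + x| - x * `|x|)| <= h ^+ 2.
  by rewrite ler_norml; case: (ler0P x) => x0; case: (ler0P (h + x)) => hx;
    apply/andP; split; nra.
have C : h^-1 *: (((fun y : R => y * `|y|) \o shift x) (h *: (1 : R)) - x * `|x|)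
    @[h --> 0^'] --> 2 * `|x|.
  apply/cvgrPdist_le => e e0; near=> h.
  have h0 : h != 0 by near: h; exact: nbhs_dnbhs_neq.
  have he : `|h| <= e.
    near: h; apply: dnbhs0_le => //.
  rewrite /shift/= /GRing.scale/= mulr1.
  apply: le_trans he.
  rewrite -(ler_pM2r (_ : 0 < `|h|)) ?normr_gt0// -normrM -expr2 real_normK ?num_real//.
  apply: le_trans (bound h); rewrite le_eqVlt; apply/orP; left; apply/eqP.
  by congr `|_|; field.
by split; [exact: (cvgP _ C)|exact: (cvg_lim (@Rhausdorff R) C)].
Unshelve. all: by end_near. Qed.

(** The boundary datum is itself a shear vanishing at [x2 = g]. *)
Lemma flow_u2_line_integral_le {R : realType} {phi : R -> R} {e g : R}
    {u : 'I_2 -> R * R -> R} {du : 'I_2 -> 'I_2 -> R * R -> R}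
    {p : R * R -> R} {B : R} :
  rough_profile phi -> 0 < e -> 0 < g -> is_flow_u2 phi e g u du p ->
  is_line_integral phi e g u du B ->
  `|B| <= e * (g + roughM phi e) ^+ 2.
Proof.
move=> h e0 g0 flow hB; have M0 := roughM_ge0 h e0.
set M := roughM phi e in M0 *.
pose W (y : R) := - ((y + M) * (g - y)).
have dW (y : R) : is_derive y (1 : R) W (2 * y + M - g).
  by apply: is_derive_eq; rewrite /GRing.scale/=; ring.
have cW' : continuous (fun y : R => 2 * y + M - g).
  move=> y; apply: cvgB; last exact: cvg_cst.
  apply: cvgD; last exact: cvg_cst.
  by apply: cvgM; [exact: cvg_cst|exact: cvg_id].
have Wg : W g = 0 by rewrite /W subrr mulr0 oppr0.
have K0 : 0 < g + M by rewrite ltr_wpDr.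
have := line_integral_near_top h e0 g0 flow hB dW cW' _ _ K0.
rewrite Wg mulr0 sub0r normrN mulrAC -expr2 mulrC; apply => //.
- by move=> i s; rewrite /e1_field/=; case: ifP => // _; rewrite Wg.
- move=> y; rewrite -/M => /andP[y1 y2].
  by rewrite ler_norml; apply/andP; split; lra.
Qed.

Lemma flow_u3_line_integral_near {R : realType} {phi : R -> R} {e g : R}
    {u : 'I_2 -> R * R -> R} {du : 'I_2 -> 'I_2 -> R * R -> R}
    {p : R * R -> R} {B : R} :
  rough_profile phi -> 0 < e -> 0 < g -> is_flow_u3 phi e g u du p ->
  is_line_integral phi e g u du B ->
  `|e - B| <= 2 / g * e * (g + roughM phi e).
Proof.
move=> h e0 g0 flow hB.
(* This is [(max(y, 0) / g)^2]: C^1, zero below height 0 and 1 at [g]. *)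
pose W (y : R) := (2 * g ^+ 2)^-1 * (y * `|y| + y * y).
have g2 : g != 0 by rewrite gt_eqF.
have dW (y : R) : is_derive y (1 : R) W ((g ^+ 2)^-1 * (`|y| + y)).
  have ds := is_derive_signed_square y.
  apply: (is_derive_eq (is_deriveZ _ (is_deriveD ds _))).
  by rewrite /GRing.scale/=; field.
have cW' : continuous (fun y : R => (g ^+ 2)^-1 * (`|y| + y)).
  move=> y; apply: cvgM; first exact: cvg_cst.
  by apply: cvgD; [apply: cvg_norm; exact: cvg_id|exact: cvg_id].
have Wg : W g = 1 by rewrite /W gtr0_norm//; field.
have W0 y : y <= 0 -> W y = 0.
  by move=> y0; rewrite /W ler0_norm// mulrN addNr mulr0.
have K0 : 0 < 2 / g by rewrite divr_gt0.
have := line_integral_near_top h e0 g0 flow hB dW cW' _ _ K0.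
rewrite Wg mulr1; apply.
- move=> i s; rewrite /e1_field/=; case: ifP => // _; rewrite W0//.
  by have /andP[] := rough_graph_range s h e0.
- by move=> i s; rewrite /e1_field/=; case: ifP => // _; rewrite Wg.
- move=> y /andP[_ yg]; rewrite normrM ger0_norm ?invr_ge0 ?sqr_ge0//.
  have -> : 2 / g = (g ^+ 2)^-1 * (2 * g) by field.
  rewrite ler_wpM2l// ?invr_ge0 ?sqr_ge0// ler_norml.
  by apply/andP; split; case: (ler0P y) => y0; lra.
Qed.

(** With [M <= g2 / 100] the two line integrals are at most [4 eps g2^2] and
[4 eps], hence the bound [1/500] on [eps]. *)
Lemma small_regime_of_bounds {R : realType} {e M g1 g2 B2 B3 : R} :
  0 < e <= 500^-1 -> 0 <= M <= g2 / 100 -> 0 < g1 <= g2 / 100 ->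
  0 < g2 <= 100^-1 -> `|B2| <= e * (g2 + M) ^+ 2 ->
  `|e - B3| <= 2 / g2 * e * (g2 + M) -> small_regime e M g1 g2 B2 B3.
Proof.
move=> /andP[e0 e1] /andP[M0 M1] hg1 /andP[g20 g21] b2 b3; split => //.
- by rewrite e0/=; lra.
- by rewrite M0.
- by rewrite g20.
- split.
    apply: (le_trans b2); rewrite expr2.
    have : (g2 + M) * (g2 + M) <= (2 * g2) * (2 * g2) by apply: ler_pM; lra.
    move=> /(ler_pM (ltW e0) (mulr_ge0 _ _) e1) h.
    by apply: (le_trans (h _ _)); nra.
  have hM : M / g2 <= 100^-1 by rewrite ler_pdivrMr// mulrC.
  have E : 2 / g2 * e * (g2 + M) = e * 2 * (1 + M / g2).
    by field; rewrite gt_eqF.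
  have : 2 / g2 * e * (g2 + M) <= 3 * e by rewrite E; nra.
  move=> /(le_trans b3)/ler_normlP[c1 c2].
  by rewrite ler_norml; apply/andP; split; lra.
Qed.

Theorem corollary3p12 (R : realType) (phi : R -> R) (hphi : rough_profile phi)
  (eps0 : R) (heps0 : 0 < eps0) (gamma1 gamma2 : R -> R)
  (hgamma : forall eps, 0 < eps < eps0 ->
     [/\ 0 < gamma1 eps, gamma1 eps < gamma2 eps & gamma2 eps < 1])
  (u2 u3 : R -> 'I_2 -> R * R -> R)
  (du2 du3 : R -> 'I_2 -> 'I_2 -> R * R -> R)
  (p2 p3 : R -> R * R -> R) (B2 B3 : R -> R)
  (hu2 : forall eps, 0 < eps < eps0 ->
     is_flow_u2 phi eps (gamma2 eps) (u2 eps) (du2 eps) (p2 eps))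
  (hB2 : forall eps, 0 < eps < eps0 ->
     is_line_integral phi eps (gamma2 eps) (u2 eps) (du2 eps) (B2 eps))
  (hu3 : forall eps, 0 < eps < eps0 ->
     is_flow_u3 phi eps (gamma2 eps) (u3 eps) (du3 eps) (p3 eps))
  (hB3 : forall eps, 0 < eps < eps0 ->
     is_line_integral phi eps (gamma2 eps) (u3 eps) (du3 eps) (B3 eps))
  (mono_gamma1 : {in `]0, eps0[ &, {homo gamma1 : e e' / e <= e'}})
  (mono_gamma2 : {in `]0, eps0[ &, {homo gamma2 : e e' / e <= e'}})
  (mono_ratio : {in `]0, eps0[ &,
     {homo (fun eps => gamma1 eps / gamma2 eps) : e e' / e <= e'}})
  (mono_eps : {in `]0, eps0[ &,
     {homo (fun eps => eps / gamma2 eps) : e e' / e <= e'}})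
  (lim_gamma1 : gamma1 eps @[eps --> 0^'+] --> 0)
  (lim_gamma2 : gamma2 eps @[eps --> 0^'+] --> 0)
  (lim_ratio : gamma1 eps / gamma2 eps @[eps --> 0^'+] --> 0)
  (lim_eps : eps / gamma2 eps @[eps --> 0^'+] --> 0)
  (lim_prod : eps * gamma2 eps / gamma1 eps @[eps --> 0^'+] --> 0) :
  (\forall eps \near 0^'+,
     cvgn (U_seq eps (roughM phi eps) (gamma1 eps) (gamma2 eps)
             (B2 eps) (B3 eps))
     /\ iteration_defined eps (roughM phi eps) (gamma1 eps) (gamma2 eps)
          (B2 eps) (B3 eps))
  /\ alpha_star eps (roughM phi eps) (gamma1 eps) (gamma2 eps) (B2 eps) (B3 eps)
       @[eps --> 0^'+] --> 0.
Proof.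
set H := profile_height phi.
have H0 : 0 < H by exact: profile_height_gt0 hphi.
have d1 : 0 < 500^-1 :> R by rewrite invr_gt0 ltr0n.
have d2 : 0 < 100^-1 :> R by rewrite invr_gt0 ltr0n.
have d3 : 0 < 100^-1 * H^-1 by rewrite mulr_gt0 ?d2 // invr_gt0.
have near_le (f : R -> R) (c : R) : f x @[x --> 0^'+] --> 0 -> 0 < c ->
    \forall x \near 0^'+, f x <= c.
  by move=> f0 c0; exact: (@cvgr_le _ _ _ _ _ _ f0).
have N0 := @nbhs_right_le R 0 _ d1.
have N1 := near_le _ _ lim_ratio d2.
have N2 := near_le _ _ lim_gamma2 d2.
have N3 := near_le _ _ lim_eps d3.
have small : \forall eps \near 0^'+, small_regime eps (roughM phi eps)
    (gamma1 eps) (gamma2 eps) (B2 eps) (B3 eps).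
  near=> eps.
  have e0 : 0 < eps by near: eps; exact: nbhs_right_gt.
  have ee0 : 0 < eps < eps0.
    by rewrite e0/=; near: eps; exact: nbhs_right_lt.
  have [g10 g12 _] := hgamma eps ee0.
  have g20 := lt_trans g10 g12.
  have M0 := roughM_ge0 hphi e0.
  have e1 : eps <= 500^-1 by near: eps; exact: N0.
  have g2s : gamma2 eps <= 100^-1.
    by near: eps; exact: N2.
  have g1s : gamma1 eps <= gamma2 eps / 100.
    rewrite mulrC -ler_pdivrMr//.
    by near: eps; exact: N1.
  have Ms : roughM phi eps <= gamma2 eps / 100.
    have : eps / gamma2 eps <= 100^-1 * H^-1 by near: eps; exact: N3.
    rewrite ler_pdivrMr// /roughM -/H => h.
    apply: le_trans (ler_wpM2r (ltW H0) h) _.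
    rewrite le_eqVlt; apply/orP; left; apply/eqP.
    by field; rewrite gt_eqF.
  have b2 := flow_u2_line_integral_le hphi e0 g20 (hu2 _ ee0) (hB2 _ ee0).
  have b3 := flow_u3_line_integral_near hphi e0 g20 (hu3 _ ee0) (hB3 _ ee0).
  by apply: small_regime_of_bounds; rewrite ?e0 ?M0 ?g10 ?g20.
split.
  apply: filterS small => eps /T12_iteration[cv def _]; by split.
apply/cvgr0Pnorm_le => e e0; near=> eps.
have ha : small_regime eps (roughM phi eps) (gamma1 eps) (gamma2 eps)
  (B2 eps) (B3 eps) by near: eps.
have [_ _ /le_trans] := T12_iteration ha; apply.
by near: eps; exact: near_le.
Unshelve. all: by end_near. Qed.
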